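(* Let $C=\{c_1,\dots,c_m\}$ be a set of $m\ge 1$ candidates, let $c_1 \rhd c_2 \rhd \cdots \rhd c_m$ be a societal axis, let $\mathrm{SP}\subseteq\mathcal{L}(C)$ be the domain of all rankings single-peaked with respect to this axis, and let $v\in\mathcal{L}(C)$ be a ranking. On input $v$ and the axis, Algorithm SP-Dist (described in the context) outputs $\mathrm{swap}(\mathrm{SP},v)=\min_{u\in \mathrm{SP}}\mathrm{swap}(u,v)$, and it runs in time $O(m^2)$.
   Context: $\mathcal{L}(C)$ is the set of all linear orders (rankings, votes) over $C$; $a\succ_v b$ means that $v$ ranks $a$ ahead of $b$. The swap distance is $\mathrm{swap}(u,v)=$ the number of unordered pairs $\{a,b\}$ of candidates whose relative order differs in $u$ and $v$. For a set of rankings $D$, $\mathrm{swap}(D,v)=\min_{u\in D}\mathrm{swap}(u,v)$. A ranking $v$ is single-peaked with respect to the axis $c_1\rhd\cdots\rhd c_m$ if for every $t\in[m]=\{1,\dots,m\}$ the set of the $t$ top-ranked candidates of $v$ is an interval of the axis (i.e., induces a connected subgraph of the path $c_1 - c_2 - \cdots - c_m$). $[\varphi]$ denotes $1$ if $\varphi$ is true and $0$ otherwise. Algorithm SP-Dist. Phase 1: for each $i\in[m]$ set $L_{i,i}=0$, $R_{i,i}=0$; for $j=i+1,\dots,m$ set $L_{i,j}=L_{i,j-1}+[c_i\succ_v c_j]$; for $j=i-1,\dots,1$ set $R_{j,i}=R_{j+1,i}+[c_i\succ_v c_j]$. Phase 2: set $A_{0,0}=0$; for $\ell=1,\dots,m-1$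 set $A_{\ell,0}=A_{\ell-1,0}+L_{\ell,m}$; for $r=1,\dots,m-1$: set $A_{0,r}=A_{0,r-1}+R_{1,m+1-r}$ and then for $\ell=1,\dots,m-r-1$ set $A_{\ell,r}=\min\bigl(A_{\ell-1,r}+L_{\ell,m-r},\ A_{\ell,r-1}+R_{\ell+1,m+1-r}\bigr)$. Output $\min_{\ell\in[m]}A_{\ell-1,m-\ell}$. *)

(* Defs.v *)
From HB Require Import structures.
From mathcomp Require Import all_boot.

Set Implicit Arguments.
Unset Strict Implicit.
Unset Printing Implicit Defensive.

(** * Rankings *)

Section Rankings.
Variable C : finType.

(* A strict linear order, as a set of pairs: [(a, b) \in r] means that [a] is
   ranked ahead of [b].  Asymmetry follows from irreflexivity and
   transitivity. *)
Definition linear_order (r : {set C * C}) : bool :=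
  [&& [forall a, (a, a) \notin r],
      [forall a, forall b, forall d,
         [&& (a, b) \in r & (b, d) \in r] ==> ((a, d) \in r)]
    & [forall a, forall b, (a != b) ==> ((a, b) \in r) || ((b, a) \in r)]].

Record ranking := Ranking { rank_rel : {set C * C}; _ : linear_order rank_rel }.
HB.instance Definition _ := [isSub for rank_rel].
HB.instance Definition _ := [Finite of ranking by <:].

Definition prefers (v : ranking) (a b : C) : bool := (a, b) \in rank_rel v.

Definition swap (u v : ranking) : nat :=
  #|[set [set ab.1; ab.2] | ab : C * C
      & (ab.1 != ab.2) && (prefers u ab.1 ab.2 != prefers v ab.1 ab.2)]|.

(* [d] is the minimum of [swap u v] over [u \in D]; in particular the minimum
   is attained, so [D] is nonempty. *)
Definition is_swap_to_domain (D : {set ranking}) (v : ranking) (d : nat) :=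
  (exists2 u, u \in D & swap u v = d) /\ (forall u, u \in D -> d <= swap u v).

Definition top_ranked (v : ranking) (t : nat) : {set C} :=
  [set a | #|[set b | prefers v b a]| < t].

(* The axis is [c], with [c i] (0-based) the candidate in position [i + 1]. *)
Definition path_edge m : rel 'I_m :=
  [rel i j : 'I_m | (i.+1 == j :> nat) || (j.+1 == i :> nat)].

Definition axis_interval m (c : 'I_m -> C) (S : {set C}) : bool :=
  [forall i, forall j, [&& c i \in S & c j \in S] ==>
     connect [rel x y | [&& c x \in S, c y \in S & path_edge x y]] i j].

Definition single_peaked m (c : 'I_m -> C) (v : ranking) : bool :=
  [forall t : 'I_m, axis_interval c (top_ranked v t.+1)].

Definition SP m (c : 'I_m -> C) : {set ranking} :=
  [set u | single_peaked c u].

(* The test [c_i \succ_v c_j], with 1-based positions [i] and [j]. *)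
Definition axis_query m (c : 'I_m -> C) (v : ranking) (i j : nat) : bool :=
  [exists x : 'I_m, exists y : 'I_m,
     [&& i == x.+1, j == y.+1 & prefers v (c x) (c y)]].

End Rankings.

(** * A unit-cost RAM language with [for] loops *)

(* Besides scalar variables and two-dimensional tables of naturals, a program
   has access to the number [m] of candidates and to the test
   [c_i \succ_v c_j], whose value as a number is 0 or 1. *)

Inductive var := Vi | Vj | Vl | Vr | Vbest.
Inductive table := TL | TR | TA.

Definition eq_var (x y : var) : bool :=
  match x, y with
  | Vi, Vi | Vj, Vj | Vl, Vl | Vr, Vr | Vbest, Vbest => true
  | _, _ => false
  end.

Definition eq_table (x y : table) : bool :=
  match x, y with
  | TL, TL | TR, TR | TA, TA => true
  | _, _ => false
  end.

Inductive expr :=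
  | EConst of nat
  | NumCand
  | EVar of var
  | EGet of table & expr & expr
  | EQuery of expr & expr
  | EAdd of expr & expr
  | ESub of expr & expr
  | EMin of expr & expr.

Inductive stmt :=
  | SAssign of var & expr
  | SStore of table & expr & expr & expr
  | SSeq of stmt & stmt
  | SForUp of var & expr & expr & stmt
  | SForDown of var & expr & expr & stmt.

Record memory := Memory {
  scalar : var -> nat;
  cell : table -> nat -> nat -> nat }.

Definition set_scalar (s : memory) (x : var) (n : nat) : memory :=
  Memory (fun y => if eq_var x y then n else scalar s y) (cell s).

Definition set_cell (s : memory) (T : table) (i j n : nat) : memory :=
  Memory (scalar s)
    (fun U a b => if [&& eq_table T U, i == a & j == b] then n
                  else cell s U a b).

Section Semantics.
Variables (m : nat) (query : nat -> nat -> bool).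

Fixpoint eval (s : memory) (e : expr) : nat :=
  match e with
  | EConst n => n
  | NumCand => m
  | EVar x => scalar s x
  | EGet T e1 e2 => cell s T (eval s e1) (eval s e2)
  | EQuery e1 e2 => query (eval s e1) (eval s e2)
  | EAdd e1 e2 => eval s e1 + eval s e2
  | ESub e1 e2 => eval s e1 - eval s e2
  | EMin e1 e2 => minn (eval s e1) (eval s e2)
  end.

Fixpoint expr_cost (e : expr) : nat :=
  match e with
  | EConst _ | NumCand | EVar _ => 1
  | EGet _ e1 e2 | EQuery e1 e2 | EAdd e1 e2 | ESub e1 e2 | EMin e1 e2 =>
      (expr_cost e1 + expr_cost e2).+1
  end.

(* The final memory and the number of elementary steps: one per operation,
   constant or memory access in an expression, one per assignment, one for
   entering a loop and one per iteration on top of the body.  The bounds of a loop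
   are evaluated once, on entry; a loop with an empty range does nothing. *)
Fixpoint exec (p : stmt) (s : memory) : memory * nat :=
  let loop x (body : memory -> memory * nat) (range : seq nat) (t0 : nat) :=
    foldl (fun st k =>
             let: (s1, t1) := st in
             let: (s2, t2) := body (set_scalar s1 x k) in
             (s2, (t1 + t2).+1))
          (s, t0) range in
  match p with
  | SAssign x e => (set_scalar s x (eval s e), (expr_cost e).+1)
  | SStore T e1 e2 e =>
      (set_cell s T (eval s e1) (eval s e2) (eval s e),
       (expr_cost e1 + expr_cost e2 + expr_cost e).+1)
  | SSeq p1 p2 =>
      let: (s1, t1) := exec p1 s in
      let: (s2, t2) := exec p2 s1 in
      (s2, t1 + t2)
  | SForUp x lo hi q =>
      loop x (exec q) (iota (eval s lo) ((eval s hi).+1 - eval s lo))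
        (expr_cost lo + expr_cost hi).+1
  | SForDown x hi lo q =>
      loop x (exec q) (rev (iota (eval s lo) ((eval s hi).+1 - eval s lo)))
        (expr_cost hi + expr_cost lo).+1
  end.

End Semantics.

(** * Algorithm SP-Dist *)

Declare Scope prog_scope.
Delimit Scope prog_scope with prog.
#[local] Coercion EConst : nat >-> expr.
#[local] Coercion EVar : var >-> expr.
Local Notation "x + y" := (EAdd x y) : prog_scope.
Local Notation "x - y" := (ESub x y) : prog_scope.
Local Notation "T '[[' i , j ']]'" := (EGet T i%prog j%prog)
  (at level 8, left associativity) : prog_scope.
Local Notation "'MIN' x y" := (EMin x%prog y%prog)
  (at level 10, x at level 9, y at level 9) : prog_scope.
Local Notation "[ i ≻ j ]" := (EQuery i%prog j%prog)
  (at level 0, i at level 50, j at level 50) : prog_scope.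
Local Notation "'SET' T '[[' i , j ']]' <~ e" := (SStore T i%prog j%prog e%prog)
  (at level 80, T at level 0, e at level 70) : prog_scope.
Local Notation "'SET' x <~ e" := (SAssign x e%prog)
  (at level 80, x at level 0, e at level 70) : prog_scope.
Local Notation "p ;; q" := (SSeq p%prog q%prog)
  (at level 90, right associativity) : prog_scope.
Local Notation "'FOR' x 'FROM' a 'UPTO' b 'DO' p 'OD'" :=
  (SForUp x a%prog b%prog p%prog)
  (at level 0, x at level 0, a at level 70, b at level 70, p at level 90)
  : prog_scope.
Local Notation "'FOR' x 'FROM' a 'DOWNTO' b 'DO' p 'OD'" :=
  (SForDown x a%prog b%prog p%prog)
  (at level 0, x at level 0, a at level 70, b at level 70, p at level 90)
  : prog_scope.

Definition phase1 : stmt := (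
  FOR Vi FROM 1 UPTO NumCand DO
    SET TL[[Vi, Vi]] <~ 0 ;;
    SET TR[[Vi, Vi]] <~ 0 ;;
    FOR Vj FROM Vi + 1 UPTO NumCand DO
      SET TL[[Vi, Vj]] <~ TL[[Vi, Vj - 1]] + [Vi ≻ Vj]
    OD ;;
    FOR Vj FROM Vi - 1 DOWNTO 1 DO
      SET TR[[Vj, Vi]] <~ TR[[Vj + 1, Vi]] + [Vi ≻ Vj]
    OD
  OD)%prog.

Definition phase2 : stmt := (
  SET TA[[0, 0]] <~ 0 ;;
  FOR Vl FROM 1 UPTO NumCand - 1 DO
    SET TA[[Vl, 0]] <~ TA[[Vl - 1, 0]] + TL[[Vl, NumCand]]
  OD ;;
  FOR Vr FROM 1 UPTO NumCand - 1 DO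
    SET TA[[0, Vr]] <~ TA[[0, Vr - 1]] + TR[[1, NumCand + 1 - Vr]] ;;
    FOR Vl FROM 1 UPTO NumCand - Vr - 1 DO
      SET TA[[Vl, Vr]] <~
        MIN (TA[[Vl - 1, Vr]] + TL[[Vl, NumCand - Vr]])
            (TA[[Vl, Vr - 1]] + TR[[Vl + 1, NumCand + 1 - Vr]])
    OD
  OD)%prog.

(* The output [min_(l in [m]) A_{l-1,m-l}], left in [Vbest]. *)
Definition output_min : stmt := (
  SET Vbest <~ TA[[0, NumCand - 1]] ;;
  FOR Vl FROM 2 UPTO NumCand DO
    SET Vbest <~ MIN Vbest (TA[[Vl - 1, NumCand - Vl]])
  OD)%prog.

Definition sp_dist : stmt := (phase1 ;; phase2 ;; output_min)%prog.

Section Run.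
Variables (C : finType) (m : nat) (c : 'I_m -> C) (v : ranking C) (s : memory).

(* [s] is the initial, arbitrary, content of the memory. *)
Definition sp_dist_result : nat :=
  scalar (exec m (axis_query c v) sp_dist s).1 Vbest.

Definition sp_dist_time : nat := (exec m (axis_query c v) sp_dist s).2.

End Run.

(* Main.v *)
(* A ranking is single-peaked iff among three candidates on the axis the middle
   one is never ranked last; hence the worst candidate of every axis interval is
   one of its endpoints.  Peeling off the worst endpoints of a single-peaked [u]
   one by one, the disagreements between [u] and [v] that involve the peeled
   candidate number exactly [L_{l,m-r}] or [R_{l+1,m+1-r}], so [swap u v] is at
   least some [A_{l,m-1-l}].  Conversely, following the choices made by the
   minima in the recurrence for [A] and successively moving the chosen endpoints
   to the bottom of the ranking yields a single-peaked ranking at that distance. *)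

Require Import Defs.
From mathcomp Require Import all_boot zify.

Set Implicit Arguments.
Unset Strict Implicit.
Unset Printing Implicit Defensive.

(** * Correctness and step bounds for RAM programs *)

Section Execution.
Variables (m : nat) (q : nat -> nat -> bool).

Notation exec := (exec m q).
Notation eval := (eval m q).

Definition runs p s (Q : memory -> Prop) T := Q (exec p s).1 /\ (exec p s).2 <= T.

Lemma runs_weaken p s Q T (Q' : memory -> Prop) T' :
  runs p s Q T -> T <= T' -> (forall s', Q s' -> Q' s') -> runs p s Q' T'.
Proof. by case=> Qs leT leT' QQ'; split; [exact: QQ' | exact: leq_trans leT']. Qed.

Lemma runs_seq p1 p2 s Q1 T1 Q2 T2 :
  runs p1 s Q1 T1 -> (forall s', Q1 s' -> runs p2 s' Q2 T2) ->
  runs (SSeq p1 p2) s Q2 (T1 + T2).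
Proof.
rewrite /runs /= => -[+ +] run2; case: (exec p1 s) => s1 t1 /= /run2[+ +] leT1.
by case: (exec p2 s1) => s2 t2 /= Q2s leT2; split=> //; apply: leq_add.
Qed.

Lemma runs_assign x e s (Q : memory -> Prop) T :
  Q (set_scalar s x (eval s e)) -> expr_cost e < T -> runs (SAssign x e) s Q T.
Proof. by []. Qed.

Lemma runs_store U e1 e2 e s (Q : memory -> Prop) T :
  Q (set_cell s U (eval s e1) (eval s e2) (eval s e)) ->
  expr_cost e1 + expr_cost e2 + expr_cost e < T ->
  runs (SStore U e1 e2 e) s Q T.
Proof. by []. Qed.

(* The bound [a <= b.+1] allows empty ranges; [I k] holds before iteration [k]. *)
Lemma runs_up x lo hi p s a b (I : nat -> memory -> Prop) T :
  eval s lo = a -> eval s hi = b -> a <= b.+1 -> I a s ->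
  (forall k s', a <= k <= b -> I k s' -> runs p (set_scalar s' x k) (I k.+1) T) ->
  runs (SForUp x lo hi p) s (I b.+1)
    ((expr_cost lo + expr_cost hi).+1 + (b.+1 - a) * T.+1).
Proof.
(* The step counter is generalized, since each iteration starts from the count left by the previous
   ones. *)
rewrite /runs /= => -> -> leab Is step; move: (_ + _).+1 => t0.
have def_b := subnKC leab; rewrite -{1}def_b {leab}; move: (b.+1 - a) def_b => n def_b.
elim: n => [|n IHn] in a s t0 def_b Is step *.
  by rewrite /= addn0 mul0n addn0.
rewrite /= addnS -addSn mulSn addnA.
have [] := step a s _ Is; first lia.
case: (exec p _) => s1 t1 /= Is1 let1.
have [|k s' lek|Iend letn] := IHn a.+1 s1 (t0 + t1).+1 _ Is1; first lia.
  by apply: step; lia.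
split=> //; lia.
Qed.

(* As the loop counts down, [I k.+1] holds before iteration [k]. *)
Lemma runs_down x hi lo p s a b (I : nat -> memory -> Prop) T :
  eval s lo = a -> eval s hi = b -> a <= b.+1 -> I b.+1 s ->
  (forall k s', a <= k <= b -> I k.+1 s' -> runs p (set_scalar s' x k) (I k) T) ->
  runs (SForDown x hi lo p) s (I a)
    ((expr_cost hi + expr_cost lo).+1 + (b.+1 - a) * T.+1).
Proof.
rewrite /runs /= => -> -> leab Is step; move: (_ + _).+1 => t0.
have {leab} := subnKC leab; move: (b.+1 - a) => n def_b.
elim: n => [|n IHn] in b s t0 def_b Is step *.
  by move: Is; rewrite -def_b /= addn0 mul0n addn0.
(* The reversed range begins with its largest element, so [iota] is split at its end. *)
rewrite -{1 2}[n.+1]addn1 iotaD rev_cat /= mulSn addnA.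
have eab: a + n = b by lia.
rewrite eab.
have [] := step b s _ Is; first lia.
case: (exec p _) => s1 t1 /= Is1 let1.
(* The induction hypothesis expects [I b'.+1] with [b = b'.+1]; at [b = 0] the range is already
   exhausted. *)
case: b => [|b] in def_b eab Is step Is1 *.
  have n0 : n = 0 by lia.
  have a0 : a = 0 by lia.
  by rewrite n0 a0 /=; split=> //; lia.
have [|k s' lek|Iend letn] := IHn b s1 (t0 + t1).+1 _ Is1; first lia.
  by apply: step; lia.
split=> //; lia.
Qed.

(** * Closed forms of the tables and the runs of the three stages *)

Definition left_cost i j := \sum_(i.+1 <= k < j.+1) q i k.
(** As with [left_cost], when [q] is the query of [v] this counts the candidates of the interval
    that overtake the endpoint [i] when it is moved below all of them. *)
Definition right_cost j i := \sum_(j <= k < i) q i k.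

(* [best_row r l] is the entry [A_{l,r}] of the algorithm. *)
Fixpoint best_row r : nat -> nat :=
  if r is r'.+1 then
    fix row l :=
      if l is l'.+1 then
        minn (row l' + left_cost l (m - r)) (best_row r' l + right_cost l.+1 (m - r'))
      else best_row r' 0 + right_cost 1 (m - r')
  else
    fix row l := if l is l'.+1 then row l' + left_cost l m else 0.
Definition best l r := best_row r l.
Arguments best : simpl never.

Lemma bestS0 l : best l.+1 0 = best l 0 + left_cost l.+1 m.
Proof. by []. Qed.

Lemma best0S r : best 0 r.+1 = best 0 r + right_cost 1 (m - r).
Proof. by []. Qed.

Lemma bestSS l r : best l.+1 r.+1 =
  minn (best l r.+1 + left_cost l.+1 (m - r.+1))
       (best l.+1 r + right_cost l.+2 (m - r)).
Proof. by []. Qed.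

(** What one iteration of the outer loop of phase 1 establishes: row [i] of [TL] and column [i] of
    [TR]. All other cells may hold arbitrary initial content. *)
Definition LR_row s i :=
  (forall j, i <= j <= m -> cell s TL i j = left_cost i j) /\
  (forall j, 0 < j <= i -> cell s TR j i = right_cost j i).

Lemma phase1_runs s :
  runs phase1 s (fun s' => forall i, 0 < i <= m -> LR_row s' i)
    (3 + m * (26 * m + 19)).
Proof.
pose I k s' := forall i, 0 < i < k -> LR_row s' i.
(* The body costs 4 for each of the two stores and at most [5 + m * 13] for each inner loop. *)
apply: runs_weaken (runs_up (a := 1) (b := m) (I := I) (T := 26 * m + 18) _ _ _ _ _)
  _ _ => //; first by move=> i; lia.
- move=> i s1 lei Is1.
  pose Q1 s' := [/\ I i s', scalar s' Vi = i & cell s' TL i i = 0].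
  apply: runs_weaken (runs_seq (Q1 := Q1) (T1 := 4)
    (T2 := 4 + ((5 + m * 13) + (5 + m * 13))) _ _) _ (fun s H => H); [| |lia].
  + apply: runs_store => //; rewrite /Q1 /= !eqxx; split=> // k lek.
    have [HL HR] := Is1 k lek; split=> j lej /=; last exact: HR.
    by rewrite ifF ?HL //; lia.
  move=> {Is1}s1 [Is1 s1i TL0].
  pose Q2 s' := [/\ I i s', scalar s' Vi = i, cell s' TR i i = 0
                  & cell s' TL i i = 0].
  apply: (runs_seq (Q1 := Q2)).
  + apply: runs_store => //; rewrite /Q2 /= s1i !eqxx; split=> // k lek.
    have [HL HR] := Is1 k lek; split=> j lej /=; first exact: HL.
    by rewrite ifF ?HR //; lia.
  move=> {Is1 s1i TL0}s1 [Is1 s1i TR0 TL0].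
  pose J j s' := [/\ I i s', scalar s' Vi = i, cell s' TR i i = 0
      & forall j', i <= j' < j -> cell s' TL i j' = left_cost i j'].
  apply: (runs_seq (Q1 := J m.+1)).
    apply: runs_weaken (runs_up (a := i.+1) (b := m) (I := J) (T := 12) _ _ _ _ _)
      _ (fun s H => H) => //=; first by rewrite s1i; lia.
    - lia.
    - split=> // j' lej'; have ->: j' = i by lia.
      by rewrite TL0 /left_cost big_geq.
    - move=> j s2 lej [Is2 s2i TR0' HL2]; apply: runs_store => //=.
      rewrite s2i; split=> //=.
        move=> k lek; have [HL HR] := Is2 k lek; split=> j' lej' /=; last exact: HR.
        by rewrite ifF ?HL //; lia.
      move=> j' lej'; rewrite eqxx /=; case: eqP => [<-|nej]; last by apply: HL2; lia.
      rewrite HL2; last by lia.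
      rewrite /left_cost subn1 prednK; last by lia.
      by rewrite big_nat_recr //=; lia.
    - lia.
  move=> {Is1 s1i TL0 TR0}s1 [Is1 s1i TR0 HL1].
  pose J' j s' := [/\ I i s', scalar s' Vi = i,
      forall j', i <= j' <= m -> cell s' TL i j' = left_cost i j'
    & forall j', j <= j' <= i -> cell s' TR j' i = right_cost j' i].
  apply: runs_weaken (runs_down (a := 1) (b := i - 1) (I := J') (T := 12) _ _ _ _ _)
      _ _ => //=; first by rewrite s1i.
  + split=> // j' lej'; have ->: j' = i by lia.
    by rewrite TR0 /right_cost big_geq.
  + move=> j s2 lej [Is2 s2i HL2 HR2]; apply: runs_store => //=.
    rewrite s2i; split=> //=.
      move=> k lek; have [HL HR] := Is2 k lek; split=> j' lej' /=; first exact: HL.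
      by rewrite ifF ?HR //; lia.
    move=> j' lej'; rewrite eqxx andbT; case: eqP => [<-|nej]; last by apply: HR2; lia.
    rewrite HR2; last by lia.
    (* Counting down extends the sum at its lower end. *)
    rewrite /right_cost addn1 [RHS]big_ltn; last by lia.
    exact: addnC.
  + lia.
  + move=> s2 [Is2 _ HL2 HR2] k lek; case: (eqVneq k i) => [->|nek]; last by apply: Is2; lia.
    by split=> j lej; [apply: HL2 | apply: HR2]; lia.
- by rewrite /=; lia.
Qed.

Definition LR_table s := forall i, 0 < i <= m -> LR_row s i.

(** Only the triangle [l + r < m] is filled. An entry depends on its neighbours at [l - 1] and
    [r - 1], which lie in the triangle and are stored earlier because [r] drives the outer loop. *)
Lemma phase2_runs s : 0 < m -> LR_table s ->
  runs phase2 s (fun s' => forall l r, l + r < m -> cell s' TA l r = best l r)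
    (13 + m * 14 + (m * (27 + m * 31))).
Proof.
move=> m0 LRs.
pose Q1 s' := LR_table s' /\ cell s' TA 0 0 = 0.
apply: runs_weaken (runs_seq (Q1 := Q1) (T1 := 4)
  (T2 := (5 + m * 14) + (4 + m * (27 + m * 31))) _ _) _ (fun s H => H); [| |lia].
  by apply: runs_store.
move=> {LRs}s [LRs A00].
pose I l s' := LR_table s' /\ forall l', l' < l -> cell s' TA l' 0 = best l' 0.
apply: (runs_seq (Q1 := I m)).
  apply: runs_weaken (runs_up (a := 1) (b := m - 1) (I := I) (T := 13) _ _ _ _ _)
      _ _ => //=; first by split=> // -[].
  - move=> l s1 lel [LR1 HA]; apply: runs_store => //=; split=> //= l' lel'.
    rewrite andbT; case: eqP => [<-|nel]; last by apply: HA; lia.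
    rewrite HA; last by lia.
    have [HL _] : LR_row s1 l by apply: LR1; lia.
    rewrite HL; last by lia.
    case: l lel {HL HA lel'} => [|l] lel; first lia.
    by rewrite bestS0 subn1.
  - by nia.
  - by move=> s1; rewrite subn1 prednK.
move=> {LRs A00}s [LRs A_0].
pose J r s' := LR_table s' /\
  forall l r', r' < r -> l + r' < m -> cell s' TA l r' = best l r'.
apply: runs_weaken (runs_up (a := 1) (b := m - 1) (I := J) (T := 26 + m * 31) _ _ _ _ _)
      _ _ => //=.
- by split=> // l [] // _ lelm; apply: A_0; lia.
- move=> r s1 ler [LR1 HA].
  pose J' l s' := [/\ J r s', scalar s' Vr = r
    & forall l', l' < l -> cell s' TA l' r = best l' r].
  apply: runs_weaken (runs_seq (Q1 := J' 1) (T1 := 17) (T2 := 7 + m * 31) _ _)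
    _ (fun s H => H); [| |lia].
    apply: runs_store => //=; split=> //=.
      split=> //= l r' ltr lelm; rewrite ifF ?HA //; lia.
    move=> [] // _; rewrite !eqxx /= HA; [|lia|lia].
    have [_ HR] : LR_row s1 (m + 1 - r) by apply: LR1; lia.
    rewrite HR; last by lia.
    (* Once [r] is replaced by [r.+1], the program's [m + 1 - r.+1] is the [m - r] of [best0S]. *)
    case: r {J' HA HR} ler => [|r] ler; first lia.
    by rewrite best0S subn1; congr (_ + right_cost _ _); lia.
  move=> s2 J's2.
  apply: runs_weaken (runs_up (a := 1) (b := m - r - 1) (I := J') (T := 30) _ _ _ _ _)
      _ _ => //=.
  + by case: J's2 => _ ->.
  + move=> l s3 lel [[LR3 HA3] s3r HAr]; apply: runs_store => //=; rewrite s3r.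
    split=> //=.
      split=> //= l' r' ltr lelm; rewrite ifF ?HA3 //; lia.
    move=> l' lel'; rewrite eqxx andbT; case: eqP => [<-|nel]; last by apply: HAr; lia.
    have [_ HR] : LR_row s3 (m + 1 - r) by apply: LR3; lia.
    have [HL _] : LR_row s3 l by apply: LR3; lia.
    rewrite HR; last by lia.
    rewrite HL; last by lia.
    rewrite HAr; last by lia.
    rewrite HA3; [|lia|lia].
    clear HR HL; case: r ler {HA J's2 J' HA3 s3r HAr} lel => [|r] ler lel; first lia.
    case: l lel {lel'} => [|l] lel; first lia.
    rewrite bestSS !subn1 addn1 /=.
    by congr (minn _ (_ + right_cost _ _)); lia.
  + by nia.
  + move=> s3 [[LR3 HA3] _ HAr]; split=> // l r' ler' lelm.
    case: (ltnP r' r) => [|ge]; first by move/HA3; apply.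
    by have ->: r' = r; [lia | apply: HAr; lia].
- by nia.
- by move=> s2 [_ H] l r lelr; apply: H; lia.
Qed.

(** The minimum is given as an attained lower bound, matching [is_swap_to_domain]; [l] stands for
    $\ell-1$. *)
Lemma output_runs s : 0 < m ->
  (forall l r, l + r < m -> cell s TA l r = best l r) ->
  runs output_min s
    (fun s' => (exists2 l, l < m & scalar s' Vbest = best l (m - l.+1)) /\
               (forall l, l < m -> scalar s' Vbest <= best l (m - l.+1)))
    (9 + m * 12).
Proof.
move=> m0 HA.
(* Before iteration [l], the entries of 0-based index below [l.-1] have been compared; the
   assignment preceding the loop handles index 0. *)
pose I l s' := [/\ forall l r, l + r < m -> cell s' TA l r = best l r,
  exists2 l', l' < l.-1 & scalar s' Vbest = best l' (m - l'.+1)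
  & forall l', l' < l.-1 -> scalar s' Vbest <= best l' (m - l'.+1)].
apply: runs_weaken (runs_seq (Q1 := I 2) (T1 := 6) (T2 := 3 + m * 12) _ _)
    _ (fun s H => H); [| |lia].
  apply: runs_assign => //=; split=> //=.
    by exists 0; rewrite // HA //; lia.
  by move=> [] // _; rewrite HA //; lia.
move=> {HA}s Is.
apply: runs_weaken (runs_up (a := 2) (b := m) (I := I) (T := 11) _ _ _ _ _)
      _ _ => //=.
- move=> l s1 lel [HA [l1 ltl1 e1] mins]; apply: runs_assign => //=.
  rewrite HA; last lia.
  split=> //=.
    case: leqP => [_|gt]; first by exists l1 => //; lia.
    by exists l.-1; [lia|congr (best _ _); lia].
  move=> l' ltl'; rewrite geq_min; case: (ltnP l' l.-1) => [/mins->//|ge].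
  apply/orP; right; apply: eq_leq; congr (best _ _); lia.
- by nia.
- by move=> s1 [].
Qed.

Lemma sp_dist_runs s : 0 < m ->
  runs sp_dist s
    (fun s' => (exists2 l, l < m & scalar s' Vbest = best l (m - l.+1)) /\
               (forall l, l < m -> scalar s' Vbest <= best l (m - l.+1)))
    (200 * m ^ 2).
Proof.
move=> m0.
apply: runs_weaken (runs_seq (phase1_runs s) _) _ (fun s H => H).
  move=> s1 LR1; apply: runs_seq (phase2_runs m0 LR1) _ => s2 HA.
  exact: output_runs.
(* The bounds add up to [57 * m ^ 2 + 72 * m + 25], at most [154 * m ^ 2] for positive [m]. *)
by rewrite expnS expn1; nia.
Qed.

End Execution.

(** * Linear orders and moving a candidate to the bottom *)

Section Rankings.
Variable C : finType.
Implicit Types (u : ranking C) (a b d x : C).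

Lemma linear_orderP (rel : {set C * C}) :
  reflect [/\ forall a, (a, a) \notin rel,
              forall a b d, (a, b) \in rel -> (b, d) \in rel -> (a, d) \in rel
            & forall a b, a != b -> ((a, b) \in rel) || ((b, a) \in rel)]
          (linear_order rel).
Proof.
apply: (iffP and3P) => -[irr tr tot]; split.
- by move=> a; apply: (forallP irr).
- move=> a b d ab bd.
  by have /forallP/(_ b)/forallP/(_ d)/implyP := forallP tr a; rewrite ab bd; apply.
- by move=> a b; have /forallP/(_ b)/implyP := forallP tot a.
- exact/forallP.
- apply/forallP=> a; apply/forallP=> b; apply/forallP=> d.
  by apply/implyP=> /andP[]; apply: tr.
- by apply/forallP=> a; apply/forallP=> b; apply/implyP; apply: tot.
Qed.

Lemma prefers_irr u a : prefers u a a = false.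
Proof. by have /linear_orderP[irr _ _] := valP u; apply/negbTE/irr. Qed.

Lemma prefers_trans u b a d : prefers u a b -> prefers u b d -> prefers u a d.
Proof. by have /linear_orderP[_ tr _] := valP u; apply: tr. Qed.

Lemma prefers_total u a b : a != b -> prefers u b a = ~~ prefers u a b.
Proof.
move=> nab; case ab: (prefers u a b).
  by apply: contraFF (prefers_irr u a); apply: prefers_trans ab.
have /linear_orderP[_ _ /(_ a b nab)] := valP u.
by rewrite -!/(prefers _ _ _) ab.
Qed.

(** The order of the candidates other than [x] is kept, so repeated demotion builds an optimal
    ranking from the bottom of the recursion outwards. *)
Definition demote_rel u x :=
  [set ab : C * C | (ab.1 != x) && ((ab.2 == x) || prefers u ab.1 ab.2)].

Lemma demote_linear u x : linear_order (demote_rel u x).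
Proof.
apply/linear_orderP; split=> [a|a b d|a b nab]; rewrite !inE /=.
- by rewrite prefers_irr orbF andNb.
- case/andP=> nax ab /andP[nbx bd]; rewrite nax; rewrite (negPf nbx) /= in ab.
  by case/orP: bd => [->//|/(prefers_trans ab)->]; rewrite orbT.
- case: (eqVneq a x) nab => [->|nax] nab /=; first by rewrite eq_sym nab.
  by case: (eqVneq b x) => //= nbx; rewrite (prefers_total _ nab) orbN.
Qed.

Definition demote u x : ranking C := Ranking (demote_linear u x).

Lemma prefers_demote u x a b :
  prefers (demote u x) a b = (a != x) && ((b == x) || prefers u a b).
Proof. by rewrite /prefers inE. Qed.

Definition num_above u a := #|[set b | prefers u b a]|.

(** Turns preferences into the numerical comparison by which [top_ranked] decides membership. *)
Lemma num_above_lt u a b : prefers u a b -> num_above u a < num_above u b.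
Proof.
move=> ab; apply: proper_card; apply/properP; split.
  by apply/subsetP=> d; rewrite !inE => /prefers_trans; apply.
by exists a; rewrite !inE ?prefers_irr.
Qed.

End Rankings.

(** * Single-peakedness as the absence of valleys on the axis *)

Section Axis.
Variables (C : finType) (m : nat) (c : 'I_m -> C) (v : ranking C).
Hypothesis c_bij : bijective c.
Implicit Types (u w : ranking C).

Let c_inj : injective c := bij_inj c_bij.

Notation q := (axis_query c).

Lemma axis_queryE u (x y : 'I_m) : q u x.+1 y.+1 = prefers u (c x) (c y).
Proof.
apply/existsP/idP => [[x' /existsP[y' /and3P[/eqP[] xx' /eqP[] yy']]]|xy].
  by rewrite (ord_inj xx') (ord_inj yy').
by exists x; apply/existsP; exists y; rewrite !eqxx.
Qed.

Lemma axis_positionP i : 0 < i <= m -> exists x : 'I_m, i = x.+1.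
Proof. by case: i => // i lti; exists (Ordinal lti). Qed.

Lemma axis_query_total u i j :
  0 < i <= m -> 0 < j <= m -> i != j -> q u j i = ~~ q u i j.
Proof.
move=> /axis_positionP[x ->] /axis_positionP[y ->] nij.
by rewrite !axis_queryE prefers_total // (inj_eq c_inj).
Qed.

Lemma axis_query_trans u j i k :
  0 < i <= m -> 0 < j <= m -> 0 < k <= m -> q u i j -> q u j k -> q u i k.
Proof.
move=> /axis_positionP[x ->] /axis_positionP[y ->] /axis_positionP[z ->].
by rewrite !axis_queryE; apply: prefers_trans.
Qed.

Lemma axis_query_demote u (p : 'I_m) i j : 0 < i <= m -> 0 < j <= m ->
  q (demote u (c p)) i j = (i != p.+1) && ((j == p.+1) || q u i j).
Proof.
move=> /axis_positionP[x ->] /axis_positionP[y ->].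
by rewrite !axis_queryE prefers_demote !(inj_eq c_inj).
Qed.

(* Axis positions are 1-based, as in the algorithm. *)
Definition valley_free u a b :=
  forall i j k, a <= i < j -> j < k <= b -> q u j i || q u j k.

(** An inner candidate is ahead of one endpoint, hence by transitivity ahead of the lower-ranked
    endpoint. *)
Lemma valley_free_bottom u a b : 0 < a -> b <= m -> a < b -> valley_free u a b ->
  (forall k, a < k <= b -> q u k a) \/ (forall k, a <= k < b -> q u k b).
Proof.
move=> a0 bm ltab vf; case ba: (q u b a); [left|right] => k lek.
  case: (eqVneq k b) => [->//|nkb].
  have /orP[//|kb] : q u k a || q u k b by apply: vf; lia.
  by apply: axis_query_trans kb ba; lia.
have ab : q u a b by rewrite (@axis_query_total _ b a) ?ba //; lia.
case: (eqVneq k a) => [->//|nka].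
have /orP[ka|//] : q u k a || q u k b by apply: vf; lia.
by apply: axis_query_trans ka ab; lia.
Qed.

(** A valley at [j] disconnects the set of candidates ahead of [j]. Without valleys, two members of
    a top set are joined by walking along the axis. *)
Lemma single_peakedP u : single_peaked c u <-> valley_free u 1 m.
Proof.
have topE t (x : 'I_m) : (c x \in top_ranked u t) = (num_above u (c x) < t).
  by rewrite inE.
split=> [/forallP sp i j k lei lek|vf].
  have /axis_positionP[x def_i] : 0 < i <= m by lia.
  have /axis_positionP[y def_j] : 0 < j <= m by lia.
  have /axis_positionP[z def_k] : 0 < k <= m by lia.
  subst i j k; rewrite !axis_queryE.
  have nxy : c x != c y by rewrite (inj_eq c_inj) -val_eqE /=; lia.
  have nzy : c z != c y by rewrite (inj_eq c_inj) -val_eqE /=; lia.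
  rewrite (prefers_total _ nxy) (prefers_total _ nzy) -negb_and.
  apply/negP => /andP[/num_above_lt xy /num_above_lt zy].
  (* The index [t] is 0-based, so this choice makes the top set exactly the candidates ahead of
     [c y]. *)
  have ltm : (num_above u (c y)).-1 < m.
    suff: num_above u (c y) <= m by lia.
    by rewrite -[m in _ <= m]card_ord (bij_eq_card c_bij) max_card.
  have /forallP/(_ x)/forallP/(_ z) := sp (Ordinal ltm).
  rewrite /= prednK; last by lia.
  rewrite !topE xy zy /= => xz.
  (* As [c y] is not in the top set, no edge within that set crosses position [y]. *)
  have cl : closed [rel s t | [&& c s \in top_ranked u (num_above u (c y)),
      c t \in top_ranked u (num_above u (c y)) & path_edge s t]] [pred s : 'I_m | s < y].
    move=> s t /= /and3P[]; rewrite !topE => sy ty st; rewrite !inE.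
    have ns : s != y by apply: contraTneq sy => ->; rewrite ltnn.
    have nt : t != y by apply: contraTneq ty => ->; rewrite ltnn.
    by move: ns nt st; rewrite -!val_eqE /path_edge /=; lia.
  have := closed_connect cl xz; rewrite !inE; lia.
apply/forallP=> t; set S := top_ranked u t.+1.
pose e := [rel x y | [&& c x \in S, c y \in S & path_edge x y]]; apply/forallP=> i; apply/forallP=> j.
apply/implyP=> /andP[]; rewrite -/e.
have up n (x y : 'I_m) : x + n = y -> c x \in S -> c y \in S -> connect e x y.
  elim: n x => [|n IHn] x exy xS yS.
    by rewrite (_ : x = y) ?connect0 //; apply: ord_inj; lia.
  have ltz : x.+1 < m by have := ltn_ord y; lia.
  pose z := Ordinal ltz.
  have zS : c z \in S.
    case: (eqVneq z y) => [->//|nzy].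
    have nzx : z != x by rewrite -val_eqE /=; lia.
    (* The next candidate is ahead of one of two members of the top set, hence is a member
       itself. *)
    have : q u z.+1 x.+1 || q u z.+1 y.+1.
      by apply: vf; have := ltn_ord y; move: nzy; rewrite -val_eqE /=; lia.
    rewrite !axis_queryE !topE in xS yS *.
    by case/orP=> /num_above_lt /ltn_trans; apply.
  apply: connect_trans (IHn z _ zS yS); last by rewrite /=; lia.
  by apply: connect1; rewrite /= xS zS /path_edge /= eqxx.
have sym_e : connect_sym e.
  by apply: sym_connect_sym => x y; rewrite /= /path_edge /= orbC andbCA.
move=> iS jS; case: (leqP i j) => [lij|/ltnW lji].
  by apply: up iS jS; apply: subnKC.
by rewrite sym_e; apply: up jS iS; apply: subnKC.
Qed.

(** * Disagreements with [v] on axis intervals *)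

Definition disagree u a b :=
  \sum_(a <= i < b.+1) \sum_(i.+1 <= j < b.+1) (q u i j != q v i j).

(** Each unordered pair of candidates has exactly one representation with increasing axis
    positions. *)
Lemma swap_disagree u : swap u v = disagree u 1 m.
Proof.
pose P := [set p : 'I_m * 'I_m | (p.1 < p.2) &&
  (prefers u (c p.1) (c p.2) != prefers v (c p.1) (c p.2))].
pose pair (p : 'I_m * 'I_m) := [set c p.1; c p.2].
have pair_inj : {in P &, injective pair}.
  move=> [x y] [x' y']; rewrite !inE /= => /andP[ltxy _] /andP[ltx'y' _] epair.
  have memE z : (z == x) || (z == y) = (z == x') || (z == y').
    by have := congr1 (fun S : {set C} => c z \in S) epair;
       rewrite !inE !(inj_eq c_inj).
  have := memE x; have := memE y; have := memE x'; have := memE y'.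
  rewrite !eqxx ?orbT -!val_eqE /= => e1 e2 e3 e4.
  by congr (_, _); apply: ord_inj; lia.
have -> : swap u v = #|pair @: P|.
  apply: eq_card => S; apply/imsetP/imsetP => -[].
    case=> a b; rewrite inE /= => /andP[nab dab] ->.
    have [x ex] : exists x, c x = a by case: c_bij => g _ gK; exists (g a).
    have [y ey] : exists y, c y = b by case: c_bij => g _ gK; exists (g b).
    subst a b; case: (ltngtP x y) => [lt|gt|/ord_inj exy].
    - by exists (x, y); rewrite // inE lt.
    - exists (y, x); last by rewrite /pair setUC.
      (* Reversing the pair negates both preferences, so disagreement is unchanged. *)
      by rewrite inE gt !(prefers_total _ nab) /= (inj_eq negb_inj).
    - by rewrite exy eqxx in nab.
  case=> x y; rewrite inE /= => /andP[ltxy dxy] ->; exists (c x, c y) => //.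
  by rewrite inE /= (inj_eq c_inj) dxy -val_eqE neq_ltn ltxy.
rewrite card_in_imset // -sum1_card /disagree big_add1 big_mkord.
under [RHS]eq_bigr => i _.
  rewrite (@big_nat_widenl _ _ _ _ 1) // big_add1 big_mkord big_mkcond.
  over.
rewrite pair_big /= [LHS]big_mkcond; apply: eq_bigr => -[x y] _ /=.
by rewrite inE /= !axis_queryE ltnS; case: (x < y) => //=; case: (_ != _).
Qed.

Lemma eq_disagree u w a b :
  (forall i j, a <= i < j -> j <= b -> q u i j = q w i j) ->
  disagree u a b = disagree w a b.
Proof.
move=> euw; apply: eq_big_nat => i lei; apply: eq_big_nat => j lej.
by rewrite euw //; lia.
Qed.

(** With [a] last in the interval under [u], a pair containing [a] is a disagreement exactly when
    [v] ranks [a] ahead, which is what [left_cost] counts. *)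
Lemma disagree_left u a b : 0 < a <= b -> b <= m ->
  (forall k, a < k <= b -> q u k a) ->
  disagree u a b = left_cost (q v) a b + disagree u a.+1 b.
Proof.
move=> lea leb bot; rewrite /disagree big_ltn; last by lia.
congr (_ + _); apply: eq_big_nat => k lek.
by rewrite (@axis_query_total _ k a) ?bot //; lia.
Qed.

Lemma disagree_right u a b : 0 < a <= b.+1 -> b < m ->
  (forall k, a <= k <= b -> q u k b.+1) ->
  disagree u a b.+1 = right_cost (q v) a b.+1 + disagree u a b.
Proof.
move=> lea leb bot; rewrite /disagree big_nat_recr /=; last by lia.
rewrite [X in _ + X]big_geq // addn0 addnC -big_split /=.
apply: eq_big_nat => i lei; rewrite big_nat_recr /=; last by lia.
congr (_ + _).
rewrite bot; last by lia.
by rewrite (@axis_query_total v b.+1 i); [case: (q v _ _) | lia ..].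
Qed.

(** The demoted candidate, at 1-based position [p.+1], is the new left endpoint and the bottom of
    the interval: it creates no valley and adds exactly its [left_cost]. *)
Lemma extend_left w (p : 'I_m) b : p < b <= m -> valley_free w p.+2 b ->
  valley_free (demote w (c p)) p.+1 b /\
  disagree (demote w (c p)) p.+1 b = left_cost (q v) p.+1 b + disagree w p.+2 b.
Proof.
move=> leb vf; split=> [i j k lei lek|].
  rewrite !axis_query_demote; [|lia..].
  case: (eqVneq i p.+1) => [_|ni]; first by apply/orP; left; lia.
  by have := vf i j k; lia.
rewrite disagree_left; [|lia|lia|]; last first.
  by move=> k lek; rewrite axis_query_demote; lia.
congr (_ + _); apply: eq_disagree => i j lei lej.
by rewrite axis_query_demote; lia.
Qed.

Lemma extend_right w (p : 'I_m) a : 0 < a <= p.+1 -> valley_free w a p ->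
  valley_free (demote w (c p)) a p.+1 /\
  disagree (demote w (c p)) a p.+1 = right_cost (q v) a p.+1 + disagree w a p.
Proof.
have ltp := ltn_ord p; move=> lea vf; split=> [i j k lei lek|].
  rewrite !axis_query_demote; [|lia..].
  case: (eqVneq k p.+1) => [_|nk]; first by apply/orP; right; lia.
  by have := vf i j k; lia.
rewrite disagree_right //; last first.
  by move=> k lek; rewrite axis_query_demote; lia.
congr (_ + _); apply: eq_disagree => i j lei lej.
by rewrite axis_query_demote; lia.
Qed.

(** * The recurrence against the swap distance *)

Notation best := (best m (q v)).

Lemma best_left_le l r : best l.+1 r <= best l r + left_cost (q v) l.+1 (m - r).
Proof. by case: r => [|r]; rewrite ?bestS0 ?subn0 ?bestSS ?geq_minl. Qed.

Lemma best_right_le l r : best l r.+1 <= best l r + right_cost (q v) l.+1 (m - r).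
Proof. by case: l => [|l]; rewrite ?best0S ?bestSS ?geq_minr. Qed.

(** Here [n] counts the peeled candidates, [l] of them from the left. Peeling the bottom endpoint
    moves its cost from the [disagree] term to [best], which grows by at most that cost. *)
Lemma best_lower u n : valley_free u 1 m -> n < m ->
  exists2 l, l <= n &
    best l (n - l) + disagree u l.+1 (m - (n - l)) <= disagree u 1 m.
Proof.
move=> vf; elim: n => [|n IHn] ltnm; first by exists 0; rewrite ?subn0.
have [l lel leD] := IHn (ltnW ltnm); set r := n - l in leD.
have vf' : valley_free u l.+1 (m - r) by move=> i j k lei lek; apply: vf; lia.
case: (valley_free_bottom _ _ _ vf'); [lia|lia|lia| |] => bot.
  exists l.+1 => //; rewrite subSS; apply: leq_trans leD.
  rewrite (disagree_left _ _ bot); [|lia|lia].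
  by rewrite addnA leq_add2r best_left_le.
exists l; first lia.
rewrite subSn //; apply: leq_trans leD.
have eb : m - r = (m - r.+1).+1 by lia.
have := best_right_le l r; rewrite eb in bot *.
rewrite disagree_right => [||//|//]; [|lia|lia].
by rewrite -/r addnA leq_add2r.
Qed.

(** Only the order of [w] inside the interval is retained; undoing the peeling by demotions along
    the minimizing branches gives equality. The nested induction follows the nested recursion of
    [best_row]. *)
Lemma best_upper l r w : l + r < m -> valley_free w l.+1 (m - r) ->
  exists2 u, valley_free u 1 m &
    disagree u 1 m = best l r + disagree w l.+1 (m - r).
Proof.
elim: r l w => [|r IHr] l w.
  elim: l w => [|l IHl] w ltm; first by rewrite subn0 => vf; exists w.
  have ltl : l < m by lia.
  case/(extend_left (p := Ordinal ltl)) => [|vf' D']; first by rewrite /=; lia.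
  have [|u vfu Du] := IHl _ _ vf'; first lia.
  by exists u => //; rewrite Du D' bestS0 subn0 addnA.
(* Shared by the boundary [l' = 0] and the right branch of the minimum. *)
have right_step l' w' : l' + r.+1 < m -> valley_free w' l'.+1 (m - r.+1) ->
    exists2 u, valley_free u 1 m & disagree u 1 m =
      best l' r + right_cost (q v) l'.+1 (m - r) + disagree w' l'.+1 (m - r.+1).
  move=> ltm; have ltp : m - r.+1 < m by lia.
  case/(extend_right (p := Ordinal ltp)) => [|/= vf' D']; first by rewrite /=; lia.
  have eb : (m - r.+1).+1 = m - r by lia.
  rewrite eb in vf' D'.
  have [|u vfu Du] := IHr _ _ _ vf'; first lia.
  by exists u => //; rewrite Du D' addnA.
elim: l w => [|l IHl] w ltm; first by rewrite best0S; apply: right_step.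
rewrite bestSS => vf; case: leqP => _; last exact: right_step.
have ltl : l < m by lia.
case/(extend_left (p := Ordinal ltl)): vf => [|vf' D']; first by rewrite /=; lia.
have [|u vfu Du] := IHl _ _ vf'; first lia.
by exists u => //; rewrite Du D' addnA.
Qed.

Lemma disagree_point u a : disagree u a a = 0.
Proof. by rewrite /disagree big_nat1 big_geq. Qed.

Lemma min_best_swap d :
  (exists2 l, l < m & d = best l (m - l.+1)) ->
  (forall l, l < m -> d <= best l (m - l.+1)) ->
  is_swap_to_domain (SP c) v d.
Proof.
move=> [l ltlm ->] min_d; split=> [|u].
  have [||u vfu] := @best_upper l (m - l.+1) v; first lia.
    by move=> i j k; lia.
  have ->: m - (m - l.+1) = l.+1 by lia.
  rewrite disagree_point addn0 => Du.
  by exists u; rewrite ?swap_disagree // inE; apply/single_peakedP.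
rewrite inE => /single_peakedP vf; rewrite swap_disagree.
(* Peeling [m.-1] candidates leaves a single one. *)
have [|l' lel'] := best_lower (n := m.-1) vf; first lia.
apply: leq_trans; have ->: m.-1 - l' = m - l'.+1 by lia.
by apply: leq_trans (leq_addr _ _); apply: min_d; lia.
Qed.

End Axis.

Theorem theorem4p3 :
  (forall (C : finType) (m : nat) (c : 'I_m -> C) (v : ranking C) (s : memory),
     0 < m -> bijective c ->
     is_swap_to_domain (SP c) v (sp_dist_result c v s))
  /\
  (exists K : nat,
     forall (C : finType) (m : nat) (c : 'I_m -> C) (v : ranking C) (s : memory),
       0 < m -> bijective c ->
       sp_dist_time c v s <= K * m ^ 2).
Proof.
split=> [C m c v s m0 c_bij|].
  have [[attained lower] _] := sp_dist_runs (axis_query c v) s m0.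
  exact: min_best_swap.
exists 200 => C m c v s m0 _.
by have [] := sp_dist_runs (axis_query c v) s m0.
Qed.
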